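(* (Minimum entropy principle.) Let $[\varrho_h,\mathbf m_h,E_h]$ be the global-in-time solution of the semi-discrete finite volume scheme (C), (M), (E) described in the context, emanating from initial data satisfying $\varrho_{0,h}>0$ and $E_{0,h}-\frac12|\mathbf m_{0,h}|^2/\varrho_{0,h}>0$, and let $s_h=\log(\vartheta_h^{c_v}/\varrho_h)$ be its entropy. Let $s_0$ be any real number with $-\infty<s_0<\min_{\Omega_h} s_h(0)$. Then $$s_h(t)\ge s_0\quad\text{for all } t\ge0 .$$
   Context: Mesh. $\Omega_h\subset\mathbb R^N$, $N\in\{1,2,3\}$, is a polyhedral domain, $\overline{\Omega}_h=\bigcup_{K\in\mathcal T_h}K$ with $\mathcal T_h$ a finite regular mesh of compact elements (two elements share at most a common face, edge or vertex), $|K|\approx h^N$, $|\sigma|\approx h^{N-1}$ for elements $K$ and faces $\sigma$. $\Sigma_{int}$ is the set of interior faces; each face carries a fixed unit normal $\mathbf n$. $Q_h(\Omega_h)$ (resp. $Q_h(\Omega_h;\mathbb R^N)$) is the set of scalar (resp. vector) functions constant on each element. Traces. On $\sigma\in\Sigma_{int}$: $v^{\rm out}(x)=\lim_{\delta\to0+}v(x+\delta\mathbf n)$, $v^{\rm in}(x)=\lim_{\delta\to0+}v(x-\delta\mathbf n)$, $\overline v=\frac12(v^{\rm in}+v^{\rm out})$, $[[v]]=v^{\rm out}-v^{\rm in}$. For a velocity $\mathbf u$: $Up[r,\mathbf u]=\overline r\,\overline{\mathbf u}\cdot\mathbf n-\frac12|\overline{\mathbf u}\cdot\mathbf n|[[r]]$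 (componentwise for vector $r$). Parameters. $\gamma>1$, $c_v=1/(\gamma-1)$, $\alpha$ a fixed real parameter; $\mu_h\ge0$ is a face-wise numerical viscosity, typically $\mu_h=hM(h,\overline{\varrho_h},\overline{\mathbf m_h},\overline{E_h})$ with $M$ continuous, regular enough for standard ODE theory to give, for each admissible initial state ($\varrho>0$ and $E-\frac12|\mathbf m|^2/\varrho>0$ on every element), a unique maximal solution of the scheme. Numerical flux: $F_h(r,\mathbf u)=Up[r,\mathbf u]-\mu_h[[r]]$ (componentwise $\mathbf F_h$ for vectors). The scheme has a unique global solution for admissible initial data, with $\varrho_h(t)>0$ and $p_h(t)>0$ for all $t\ge0$. Scheme (semi-discrete; unknowns $\varrho_h,E_h\in Q_h(\Omega_h)$, $\mathbf m_h\in Q_h(\Omega_h;\mathbb R^N)$ are functions of time $t$), with $\mathbf u_h=\mathbf m_h/\varrho_h$, $p_h=(\gamma-1)\big(E_h-\frac12|\mathbf m_h|^2/\varrho_h\big)$, temperature $\vartheta_h=p_h/\varrho_h$: (C) $\int_{\Omega_h}\frac{d}{dt}\varrho_h\,\Phi\,dx-\sum_{\sigma\in\Sigma_{int}}\int_\sigma F_h(\varrho_h,\mathbf u_h)[[\Phi]]\,dS_h=0$ for all $\Phi\in Q_h(\Omega_h)$; (M) $\int_{\Omega_h}\frac{d}{dt}\mathbf m_h\cdot\boldsymbol\Phi\,dx-\sum_{\sigma\in\Sigma_{int}}\int_\sigma\mathbf F_h(\mathbf m_h,\mathbf u_h)\cdot[[\boldsymbol\Phi]]\,dS_h-\sum_{\sigma\in\Sigma_{int}}\int_\sigma\overline{p_h}\,\mathbf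 n\cdot[[\boldsymbol\Phi]]\,dS_h=-h^{\alpha-1}\sum_{\sigma\in\Sigma_{int}}\int_\sigma[[\mathbf u_h]]\cdot[[\boldsymbol\Phi]]\,dS_h$ for all $\boldsymbol\Phi\in Q_h(\Omega_h;\mathbb R^N)$; (E) $\int_{\Omega_h}\frac{d}{dt}E_h\,\Phi\,dx-\sum_{\sigma\in\Sigma_{int}}\int_\sigma F_h(E_h,\mathbf u_h)[[\Phi]]\,dS_h-\sum_{\sigma\in\Sigma_{int}}\int_\sigma\overline{p_h}\,[[\Phi\mathbf u_h]]\cdot\mathbf n\,dS_h+\sum_{\sigma\in\Sigma_{int}}\int_\sigma\overline{p_h\Phi}\,[[\mathbf u_h]]\cdot\mathbf n\,dS_h=-h^{\alpha-1}\sum_{\sigma\in\Sigma_{int}}\int_\sigma[[\mathbf u_h]]\cdot\overline{\mathbf u_h}\,[[\Phi]]\,dS_h$ for all $\Phi\in Q_h(\Omega_h)$. Boundary conditions: no-flux, $\mathbf u_h\cdot\mathbf n=0$ on every face in $\partial\Omega_h$, with $\varrho_h,p_h$ extrapolated ($\partial\varrho_h/\partial\mathbf n=\partial p_h/\partial\mathbf n=0$). *)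

(* Defs.v *)
From HB Require Import structures.
From mathcomp Require Import all_boot all_order all_algebra.
From mathcomp Require Import all_classical all_reals all_analysis.

Set Implicit Arguments.
Unset Strict Implicit.
Unset Printing Implicit Defensive.

Import Order.TTheory GRing.Theory Num.Theory.
Import numFieldNormedType.Exports.

Local Open Scope classical_set_scope.
Local Open Scope ring_scope.

(* MathComp-Analysis; points and vectors of R^N are row vectors. *)

Definition dot (R : realType) (N : nat) (x y : 'rV[R]_N) : R :=
  \sum_j x 0 j * y 0 j.

Section Simplices.
Variables (R : realType) (N : nat).
Implicit Types (v w : 'I_N.+1 -> 'rV[R]_N) (i : 'I_N.+1).

(* The convex hull of the points [v i] with [P i] (empty if there are none). *)
Definition hull (P : pred 'I_N.+1) v : set 'rV[R]_N :=
  [set x | exists c : 'I_N.+1 -> R,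
     [/\ forall i, 0 <= c i, \sum_(i | P i) c i = 1
       & x = \sum_(i | P i) c i *: v i]].

Definition is_vertex v (x : 'rV[R]_N) : bool := [exists i, v i == x].

Definition simplex_volume v : R :=
  `|\det (\matrix_(i < N, j < N) (v (lift ord0 i) 0 j - v ord0 0 j))| / N`!%:R.

(* The facet opposite to vertex [i] has the vertices [v (lift i j)], j < N.
   Its (N-1)-dimensional measure is the Euclidean norm of the vector whose
   k-th component is, up to sign, the measure of the projection of the facet
   along the k-th axis; (N-1)! times that measure is the determinant of the
   vertex matrix with its k-th column replaced by ones.  For N = 1, 2, 3 this
   gives 1, the length of the edge, and half the norm of the cross product of
   two edges. *)
Definition facet_area v i : R :=
  Num.sqrt (\sum_(k < N)
    (\det (\matrix_(j < N, l < N)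
       (if l == k then 1 else v (lift i j) 0 l))) ^+ 2) / (N.-1)`!%:R.

(* The facet opposite to [i] lies in the hyperplane n . x = d, and the simplex
   in the half-space n . x <= d: if |n| = 1, n is the outer unit normal. *)
Definition facet_in_plane v i (n : 'rV[R]_N) (d : R) : Prop :=
  (forall j : 'I_N, dot n (v (lift i j)) = d) /\ dot n (v i) < d.

End Simplices.

(* A simplicial facet of a family of N-simplices indexed by [S] is a pair
   (simplex, opposite vertex).  Twins are the two sides of the same facet. *)
Definition twin (R : realType) (N : nat) (S : finType)
    (vtx : S -> 'I_N.+1 -> 'rV[R]_N) (f g : S * 'I_N.+1) : Prop :=
  f.1 <> g.1 /\
  forall j : 'I_N, exists j' : 'I_N,
    vtx f.1 (lift f.2 j) = vtx g.1 (lift g.2 j').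

(* [F] is a nonempty flat piece of the boundary of the element [K], contained
   in a hyperplane with unit normal [n] pointing out of [K] along [F]. *)
Definition flat_face (R : realType) (N : nat) (S C : finType)
    (vtx : S -> 'I_N.+1 -> 'rV[R]_N) (owner : S -> C)
    (K : C) (n : 'rV[R]_N) (F : {set S * 'I_N.+1}) : Prop :=
  [/\ F != finset.set0, dot n n = 1
    & exists d : R, forall f, f \in F ->
        owner f.1 = K /\ facet_in_plane (vtx f.1) f.2 n d].

(* The point set of the element [K]. *)
Definition element_set (R : realType) (N : nat) (S C : finType)
    (vtx : S -> 'I_N.+1 -> 'rV[R]_N) (owner : S -> C) (K : C) : set 'rV[R]_N :=
  [set x | exists2 T : S, owner T = K & hull predT (vtx T) x].

(* The point set of a set of simplicial facets. *)
Definition face_set (R : realType) (N : nat) (S : finType)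
    (vtx : S -> 'I_N.+1 -> 'rV[R]_N) (F : {set S * 'I_N.+1}) : set 'rV[R]_N :=
  [set x | exists2 f, f \in F & hull (predC1 f.2) (vtx f.1) x].

(* A polyhedral mesh in R^N.  As usual for compact polyhedra, the elements are
   finite unions of simplices; the finitely many simplices used form a
   conforming triangulation of the whole domain.  The elements need be neither
   simplices nor convex.  A face is a set of coplanar simplicial facets, an
   interior one being listed from the side its normal points out of. *)
Record mesh (R : realType) (N : nat) := Mesh {
  simp : finType;
  cell : finType;
  iface : finType;
  bface : finType;
  vtx : simp -> 'I_N.+1 -> 'rV[R]_N;
  owner : simp -> cell;
  cell_in : iface -> cell;
  cell_out : iface -> cell;
  normal : iface -> 'rV[R]_N;
  facets : iface -> {set simp * 'I_N.+1};
  bcell : bface -> cell;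
  bnormal : bface -> 'rV[R]_N;
  bfacets : bface -> {set simp * 'I_N.+1};
  simp_nondegenerate : forall T, 0 < simplex_volume (vtx T);
  simp_inj : forall T T',
    (forall i, is_vertex (vtx T') (vtx T i)) -> T = T';
  simp_conforming : forall T T',
    hull predT (vtx T) `&` hull predT (vtx T') `<=`
    hull (fun i => is_vertex (vtx T') (vtx T i)) (vtx T);
  owner_surj : forall K, exists T, owner T = K;
  (* interior faces: the facets separating two different elements *)
  iface_flat : forall s,
    flat_face vtx owner (cell_in s) (normal s) (facets s);
  iface_sides : forall s, cell_in s <> cell_out s;
  iface_twin : forall s f, f \in facets s ->
    exists2 g, twin vtx f g & owner g.1 = cell_out s;
  iface_cover : forall f g, twin vtx f g -> owner f.1 <> owner g.1 ->
    exists! s, f \in facets s \/ g \in facets s;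
  (* boundary faces: the facets belonging to a single simplex *)
  bface_flat : forall b,
    flat_face vtx owner (bcell b) (bnormal b) (bfacets b);
  bface_twin : forall b f, f \in bfacets b -> forall g, ~ twin vtx f g;
  bface_cover : forall f, (forall g, ~ twin vtx f g) ->
    exists! b, f \in bfacets b;
  (* two elements are disjoint, or meet in a common face, or meet in a set of
     dimension at most N - 2 (contained in an edge or a vertex) *)
  mesh_regular : forall K L, K <> L ->
    let KL := element_set vtx owner K `&` element_set vtx owner L in
    [\/ KL = set0,
        exists s, ((cell_in s = K /\ cell_out s = L) \/
                   (cell_in s = L /\ cell_out s = K)) /\
                  KL = face_set vtx (facets s)
      | exists (x0 : 'rV[R]_N) (A : 'M[R]_N), (\rank A + 2 <= N)%N /\
          forall x, KL x -> (x - x0 <= A)%MS];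
  (* the domain is the interior of the union of the elements *)
  mesh_connected :
    connected (interior (\bigcup_(K in [set: cell]) element_set vtx owner K))
}.

Section Scheme.
Variables (R : realType) (N : nat) (M : mesh R N).

Definition vol (K : cell M) : R :=
  \sum_(T : simp M | owner T == K) simplex_volume (vtx T).

Definition area (s : iface M) : R :=
  \sum_(f in facets s) facet_area (vtx f.1) f.2.

Definition barea (b : bface M) : R :=
  \sum_(f in bfacets b) facet_area (vtx f.1) f.2.

(* |K| ~ h^N and |sigma| ~ h^(N-1) with comparison constants c, 1/c *)
Definition size_comparable (h c : R) : Prop :=
  [/\ forall K, c * h ^+ N <= vol K <= c^-1 * h ^+ N,
      forall s, c * h ^+ N.-1 <= area s <= c^-1 * h ^+ N.-1
    & forall b, c * h ^+ N.-1 <= barea b <= c^-1 * h ^+ N.-1].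

(* Elementwise constant scalar and vector functions. *)
Definition Qh : Type := cell M -> R.
Definition QhV : Type := cell M -> 'rV[R]_N.

(* For x on the face s and small delta > 0, x + delta n lies in [cell_out s] and
   x - delta n in [cell_in s]: these are the values of the traces. *)
Definition jump (W : zmodType) (v : cell M -> W) (s : iface M) : W :=
  v (cell_out s) - v (cell_in s).
Definition avg (v : Qh) (s : iface M) : R :=
  2^-1 * (v (cell_in s) + v (cell_out s)).
Definition avgV (v : QhV) (s : iface M) : 'rV[R]_N :=
  2^-1 *: (v (cell_in s) + v (cell_out s)).

(* Integrals over the domain and over all interior faces of functions that are
   constant on each element, respectively on each face. *)
Definition int_dom (f : Qh) : R := \sum_K vol K * f K.
Definition int_faces (f : iface M -> R) : R := \sum_s area s * f s.

Definition Up (r : Qh) (u : QhV) (s : iface M) : R :=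
  avg r s * dot (avgV u s) (normal s)
  - 2^-1 * `|dot (avgV u s) (normal s)| * jump r s.

Definition flux (mu : iface M -> R) (r : Qh) (u : QhV) (s : iface M) : R :=
  Up r u s - mu s * jump r s.

Definition fluxV (mu : iface M -> R) (r u : QhV) (s : iface M) : 'rV[R]_N :=
  \row_j flux mu (fun K => r K 0 j) u s.

Record state := State { rho : Qh; mom : QhV; ener : Qh }.

Definition velocity (X : state) : QhV := fun K => (rho X K)^-1 *: mom X K.

Definition pressure (gamma : R) (X : state) : Qh := fun K =>
  (gamma - 1) * (ener X K - 2^-1 * (dot (mom X K) (mom X K) / rho X K)).

Definition temperature (gamma : R) (X : state) : Qh := fun K =>
  pressure gamma X K / rho X K.

Definition entropy (gamma : R) (X : state) : Qh := fun K =>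
  let cv := (gamma - 1)^-1 in ln (temperature gamma X K `^ cv / rho X K).

Definition admissible (X : state) : Prop := forall K,
  0 < rho X K /\ 0 < ener X K - 2^-1 * (dot (mom X K) (mom X K) / rho X K).

Definition no_flux (u : QhV) : Prop :=
  forall b : bface M, dot (u (bcell b)) (bnormal b) = 0.

Definition continuity_eq (mu : iface M -> R) (X : state) (drho : Qh) : Prop :=
  let u := velocity X in
  forall Phi : Qh,
    int_dom (fun K => drho K * Phi K)
    - int_faces (fun s => flux mu (rho X) u s * jump Phi s) = 0.

Definition momentum_eq (V : set QhV) (gamma alpha h : R) (mu : iface M -> R)
    (X : state) (dmom : QhV) : Prop :=
  let u := velocity X in let p := pressure gamma X in
  forall Phi : QhV, V Phi ->
    int_dom (fun K => dot (dmom K) (Phi K))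
    - int_faces (fun s => dot (fluxV mu (mom X) u s) (jump Phi s))
    - int_faces (fun s => avg p s * dot (normal s) (jump Phi s))
    = - (h `^ (alpha - 1) * int_faces (fun s => dot (jump u s) (jump Phi s))).

Definition energy_eq (gamma alpha h : R) (mu : iface M -> R)
    (X : state) (dener : Qh) : Prop :=
  let u := velocity X in let p := pressure gamma X in
  forall Phi : Qh,
    int_dom (fun K => dener K * Phi K)
    - int_faces (fun s => flux mu (ener X) u s * jump Phi s)
    - int_faces (fun s =>
        avg p s * dot (jump (fun K => Phi K *: u K) s) (normal s))
    + int_faces (fun s =>
        avg (fun K => p K * Phi K) s * dot (jump u s) (normal s))
    = - (h `^ (alpha - 1) *
         int_faces (fun s => dot (jump u s) (avgV u s) * jump Phi s)).

(* A global solution: continuous on [0, +oo[, and satisfying the scheme for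
   t > 0.  The viscosity is any function of time and face; mu_h = h M(...) is
   its value along the solution.  [V] is the class of test functions of the
   momentum equation: V = setT is all of Q_h(Omega_h; R^N).  With V = setT the
   tests not tangential to the wall see the sums over interior faces without
   the wall pressure; V = no_flux keeps only the tests obeying the same wall
   condition as the velocity.  The extrapolation of density and pressure only
   fixes ghost values outside the domain, which the scheme does not use. *)
Definition global_solution (V : set QhV) (gamma alpha h : R)
    (mu : R -> iface M -> R) (X : R -> state) : Prop :=
  [/\ forall K, [/\ {within `[0, +oo[, continuous (fun t => rho (X t) K)},
        {within `[0, +oo[, continuous (fun t => ener (X t) K)}
        & forall j, {within `[0, +oo[, continuous (fun t => mom (X t) K 0 j)}],
      forall t, 0 < t -> forall K, [/\ derivable (fun t => rho (X t) K) t 1,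
        derivable (fun t => ener (X t) K) t 1
        & forall j, derivable (fun t => mom (X t) K 0 j) t 1],
      forall t, 0 < t -> [/\
        continuity_eq (mu t) (X t) (fun K => derive1 (fun t => rho (X t) K) t),
        momentum_eq V gamma alpha h (mu t) (X t)
          (fun K => \row_j derive1 (fun t => mom (X t) K 0 j) t)
        & energy_eq gamma alpha h (mu t) (X t)
          (fun K => derive1 (fun t => ener (X t) K) t)],
      forall t, 0 <= t -> no_flux (velocity (X t))
    & forall t, 0 <= t -> forall K,
        0 < rho (X t) K /\ 0 < pressure gamma (X t) K].

End Scheme.

(* Main.v *)
Require Import Defs.
From HB Require Import structures.
From mathcomp Require Import all_boot all_order all_algebra perm.
From mathcomp Require Import all_classical all_reals all_analysis.
From mathcomp Require Import ring lra.
Import Order.TTheory GRing.Theory Num.Theory.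
Import numFieldNormedType.Exports.
Local Open Scope classical_set_scope.
Local Open Scope ring_scope.

Set Implicit Arguments.
Unset Strict Implicit.
Unset Printing Implicit Defensive.

(* Up to the factor c_v the entropy is ln p - gamma ln rho.  Testing (C) and
   (E) with the indicator 1_K of an element and (M) with 1_K u_K, which obeys
   the wall condition, gives for the time derivative of this quantity on K,
   multiplied by |K|, the sum over the faces of K of |sigma| times
     B (p_L/p_K - gamma rho_L/rho_K + gamma - 1) + (gamma - 1) u_K . n
   plus nonnegative dissipation, where L is the neighbour and B >= 0 the upwind
   weight of L.  If K minimizes the entropy, then
   p_L/p_K >= (rho_L/rho_K)^gamma and Bernoulli's inequality makes the first
   term nonnegative.  The second one sums to zero because the outer area vectors
   of the faces of K add up to zero and u_K . n = 0 on the walls.  So the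
   minimum over the elements cannot decrease. *)

(** * Dot product of row vectors *)

Section Dot.
Context {R : realType} {N : nat}.
Implicit Types (x y z : 'rV[R]_N).

Lemma dotZr (a : R) x y : dot x (a *: y) = a * dot x y.
Proof. by rewrite /dot mulr_sumr; apply: eq_bigr => j _; rewrite mxE mulrCA. Qed.

Lemma dotNr x y : dot x (- y) = - dot x y.
Proof. by rewrite -scaleN1r dotZr mulN1r. Qed.

Lemma dot_sumr (I : Type) (r : seq I) (P : pred I) x
    (F : I -> 'rV[R]_N) :
  dot x (\sum_(i <- r | P i) F i) = \sum_(i <- r | P i) dot x (F i).
Proof.
rewrite /dot exchange_big/=; apply: eq_bigr => j _.
by rewrite summxE mulr_sumr.
Qed.

Lemma dotC x y : dot x y = dot y x.
Proof. by apply: eq_bigr => j _; rewrite mulrC. Qed.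

Lemma dotDr x y z : dot x (y + z) = dot x y + dot x z.
Proof.
by rewrite /dot -big_split; apply: eq_bigr => j _; rewrite mxE mulrDr.
Qed.

Lemma dotBr x y z : dot x (y - z) = dot x y - dot x z.
Proof. by rewrite dotDr dotNr. Qed.

Lemma dotBl x y z : dot (x - y) z = dot x z - dot y z.
Proof. by rewrite dotC dotBr !(dotC z). Qed.

Lemma dotDl x y z : dot (x + y) z = dot x z + dot y z.
Proof. by rewrite dotC dotDr !(dotC z). Qed.

Lemma dotZl a x y : dot (a *: x) y = a * dot x y.
Proof. by rewrite dotC dotZr dotC. Qed.

Lemma dot_ge0 x : 0 <= dot x x.
Proof. by apply: sumr_ge0 => j _; rewrite -expr2 sqr_ge0. Qed.

Lemma dot_sub_mean_l x y :
  dot (y - x) (2^-1 *: (x + y)) - dot (y - x) x = dot (y - x) (y - x) / 2.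
Proof. by rewrite dotZr dotDr dotBr; field. Qed.

Lemma dot_sub_mean_r x y :
  dot (y - x) (2^-1 *: (x + y)) - dot (y - x) y = - (dot (x - y) (x - y) / 2).
Proof.
have -> : dot (x - y) (x - y) = dot (y - x) (y - x).
  by rewrite -(opprB y x) dotNr (dotC (- _)) dotNr opprK.
by rewrite dotZr dotDr dotBr; field.
Qed.

End Dot.

(** * Area vectors of simplices *)

Section Barycentric.
Context {R : realType} {N : nat}.
Implicit Types (v w : 'I_N.+1 -> 'rV[R]_N) (i : 'I_N.+1) (x y : 'rV[R]_N).

(** Homogeneous coordinates with the constant 1 in slot [ord0]: affine functions of [x] become
    linear functions of [homog x]. *)
Definition homog x : 'rV[R]_N.+1 :=
  \row_k (if unlift ord0 k is Some l then x 0 l else 1).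

Lemma homog0 x : homog x 0 ord0 = 1.
Proof. by rewrite mxE unlift_none. Qed.

Lemma homogS x l : homog x 0 (lift ord0 l) = x 0 l.
Proof. by rewrite mxE liftK. Qed.

Lemma homog_inj : injective homog.
Proof.
by move=> x y xy; apply/rowP => l; rewrite -!homogS xy.
Qed.

Definition vmx v : 'M[R]_N.+1 := \matrix_i homog (v i).

(** For invertible [vmx v] these are the barycentric coordinates of [x]: the weights that write
    [homog x] as a combination of the rows of [vmx v]. *)
Definition bary v x i : R := (homog x *m invmx (vmx v)) 0 i.

(** A kernel vector is an affine function vanishing at all vertices. Its linear part kills the edges
    issuing from vertex 0, which are independent, so it is zero; then the constant term is zero as
    well. *)
Lemma vmx_unit v : 0 < simplex_volume v -> vmx v \in unitmx.
Proof.
rewrite /simplex_volume => vol_gt0.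
have {vol_gt0} : \matrix_(i < N, j < N) (v (lift ord0 i) 0 j - v ord0 0 j)
    \in unitmx.
  rewrite unitmxE unitfE; apply: contraTneq vol_gt0 => ->.
  by rewrite normr0 mul0r ltxx.
move=> Dunit; rewrite -unitmx_tr -row_free_unit -kermx_eq0.
apply/eqP/row_matrixP => i; rewrite row0; set c := row i _.
have : c *m (vmx v)^T = 0 by rewrite /c -row_mul mulmx_ker row0.
move: c => {i} c /rowP cP.
have cPE j : c 0 ord0 + \sum_l c 0 (lift ord0 l) * v j 0 l = 0.
  have := cP j; rewrite [RHS]mxE => {2}<-; rewrite [RHS]mxE big_ord_recl.
  congr (_ + _); first by rewrite !mxE unlift_none mulr1.
  by apply: eq_bigr => l _; rewrite !mxE liftK.
pose c' : 'rV[R]_N := \row_l c 0 (lift ord0 l).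
have c'0 : c' = 0.
  have : c' *m (\matrix_(i < N, j < N) (v (lift ord0 i) 0 j - v ord0 0 j))^T = 0.
    apply/rowP => j; rewrite !mxE.
    have /addrI E := etrans (cPE (lift ord0 j)) (esym (cPE ord0)).
    move/eqP: E; rewrite -subr_eq0 -sumrB => /eqP sum0; rewrite -[RHS]sum0.
    by apply: eq_bigr => l _; rewrite !mxE mulrBr.
  by move/(congr1 (mulmx ^~ (invmx
    (\matrix_(i < N, j < N) (v (lift ord0 i) 0 j - v ord0 0 j))^T)));
    rewrite mulmxK ?unitmx_tr// mul0mx.
apply/rowP => k; rewrite [RHS]mxE; have [l ->|->] := unliftP ord0 k.
  by have /rowP/(_ l) := c'0; rewrite !mxE.
have := cPE ord0; rewrite big1 ?addr0// => l _.
by have /rowP/(_ l) := c'0; rewrite !mxE => ->; rewrite mul0r.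
Qed.

Lemma vmx_inj v : vmx v \in unitmx -> injective v.
Proof.
move=> Pu i j vij; apply/eqP; apply: contraT => /eqP ij.
have : \det (vmx v) != 0 by rewrite -unitfE -unitmxE.
by rewrite (determinant_alternate (i1 := i) (i2 := j)) ?eqxx//;
  [exact/eqP|move=> k; rewrite !mxE vij].
Qed.

Lemma homog_sum (P : pred 'I_N.+1) (c : 'I_N.+1 -> R) v :
  \sum_(i | P i) c i = 1 ->
  homog (\sum_(i | P i) c i *: v i) = \sum_(i | P i) c i *: homog (v i).
Proof.
move=> c1; apply/rowP => k; rewrite summxE.
have [l ->|->] := unliftP ord0 k.
  by rewrite homogS summxE; apply: eq_bigr => i _; rewrite !mxE liftK.
by rewrite homog0 -c1; apply: eq_bigr => i _; rewrite !mxE unlift_none mulr1.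
Qed.

Lemma bary_vertex v i j : vmx v \in unitmx -> bary v (v i) j = (i == j)%:R.
Proof.
move=> Pu; rewrite /bary.
have -> : homog (v i) = row i (vmx v) by rewrite rowK.
by rewrite -row_mul mulmxV// rowE mulmx1 mxE eqxx eq_sym.
Qed.

Lemma bary_sum (P : pred 'I_N.+1) (c : 'I_N.+1 -> R) v w j :
  \sum_(i | P i) c i = 1 ->
  bary w (\sum_(i | P i) c i *: v i) j = \sum_(i | P i) c i * bary w (v i) j.
Proof.
move=> c1; rewrite /bary homog_sum// mulmx_suml summxE.
by apply: eq_bigr => i _; rewrite -scalemxAl mxE.
Qed.

(** Coordinate [i] vanishes at every other vertex, so it cannot be positive on a combination that
    omits vertex [i]. *)
Lemma bary_hull v (P : pred 'I_N.+1) x i : vmx v \in unitmx -> hull P v x ->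
  0 < bary v x i -> P i.
Proof.
move=> Pu [c [c_ge0 c1 ->]]; rewrite bary_sum//.
apply: contraTT => nPi; rewrite big1 ?ltxx// => j Pj.
by rewrite bary_vertex//; case: eqP nPi => [<-|]; rewrite ?Pj ?mulr0.
Qed.

Lemma bary_ge0_hull v x : vmx v \in unitmx -> (forall i, 0 <= bary v x i) ->
  hull predT v x.
Proof.
move=> Pu b_ge0; exists (bary v x).
have E : homog x = \sum_i bary v x i *: homog (v i).
  rewrite -[LHS](mulmxKV Pu) mulmx_sum_row.
  by apply: eq_bigr => i _; rewrite rowK.
have b1 : \sum_i bary v x i = 1.
  have /rowP/(_ ord0) := E; rewrite homog0 summxE => ->.
  by apply: eq_bigr => i _; rewrite mxE homog0 mulr1.
split=> //; apply: homog_inj; rewrite homog_sum//.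
Qed.

(** The gradient of the affine function [bary v x i] of [x]. *)
Definition bgrad v i : 'rV[R]_N :=
  \row_k invmx (vmx v) (lift ord0 k) i.

(* The outer normal of the facet opposite to vertex [i], with length the area
   of the facet. *)
Definition area_vec v i : 'rV[R]_N :=
  - (`|\det (vmx v)| / N.-1`!%:R) *: bgrad v i.

(** The barycentric coordinates add up to the constant 1, so their gradients add up to zero. *)
Lemma sum_area_vec v : vmx v \in unitmx -> \sum_i area_vec v i = 0.
Proof.
move=> Pu; rewrite -scaler_sumr; apply/eqP; rewrite scaler_eq0; apply/orP; right.
apply/eqP/rowP => k; rewrite summxE [RHS]mxE.
have /matrixP/(_ (lift ord0 k) ord0) := mulVmx Pu.
rewrite !mxE /= => E; rewrite -[RHS]E; apply: eq_bigr => i _.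
by rewrite !mxE unlift_none mulr1.
Qed.

Lemma det_invmx v i k : vmx v \in unitmx ->
  \det (vmx v) * invmx (vmx v) k i = cofactor (vmx v) i k.
Proof.
move=> Pu; rewrite /invmx Pu !mxE mulrA divff ?mul1r//.
by rewrite -unitfE -unitmxE.
Qed.

End Barycentric.

(** By Cramer's rule the entries of [bgrad v i] times the determinant are cofactors of [vmx v]. Up
    to sign these are the determinants in [facet_area], and squaring removes the sign. *)
Lemma facet_areaE (R : realType) (N : nat) (v : 'I_N.+1 -> 'rV[R]_N) i :
  vmx v \in unitmx ->
  facet_area v i
  = `|\det (vmx v)| / N.-1`!%:R * Num.sqrt (dot (bgrad v i) (bgrad v i)).
Proof.
move=> Pu; rewrite /facet_area mulrAC; congr (_ / _).
rewrite -sqrtr_sqr -sqrtrM ?sqr_ge0//; congr Num.sqrt.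
rewrite /dot mulr_sumr; apply: eq_bigr => k _.
rewrite -expr2 -exprMn mxE det_invmx// /cofactor exprMn -exprM mulnC exprM.
rewrite sqrrN expr1n expr1n mul1r.
case: N v i k Pu => [v i []//|n v i k Pu].
(* The minor keeps the ones in column 0, [facet_area] has them in column [k]; the permutation moves
   that column and leaves the order of the others. *)
have -> : row' i (col' (lift ord0 k) (vmx v)) =
    col_perm (lift_perm ord0 k 1)
      (\matrix_(j < n.+1, l < n.+1) (if l == k then 1 else v (lift i j) 0 l)).
  apply/matrixP => j l; rewrite !mxE.
  have [l' ->|->] := unliftP ord0 l.
    rewrite lift_perm_lift perm1 eq_sym eq_liftF.
    have -> : lift (lift ord0 k) (lift ord0 l') = lift ord0 (lift k l').
      by apply/val_inj; rewrite /= /bump !add1n ltnS addnS.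
    by rewrite liftK.
  rewrite lift_perm_id eqxx.
  have -> : lift (lift ord0 k) ord0 = ord0 :> 'I_n.+2 by apply/val_inj.
  by rewrite unlift_none.
rewrite col_permE det_mulmx det_perm exprMn -exprM mulnC exprM sqrrN !expr1n.
by rewrite mulr1.
Qed.

Section AreaVector.
Context {R : realType} {N : nat}.
Implicit Types (v w : 'I_N.+1 -> 'rV[R]_N) (i : 'I_N.+1) (x y : 'rV[R]_N).

(** The affine function [d - n . x], with homogeneous coefficients [y], vanishes on the facet and
    equals [tau > 0] at vertex [i]. So it is [tau] times the barycentric coordinate [i], whence
    [n = - tau *: bgrad v i], and [|n| = 1] fixes the length of the gradient. *)
Lemma area_vecE v i n d : vmx v \in unitmx -> dot n n = 1 ->
  facet_in_plane v i n d -> area_vec v i = facet_area v i *: n.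
Proof.
move=> Pu n1 [Hd Hi].
pose y : 'cV[R]_N.+1 := \col_k (if unlift ord0 k is Some l then - n 0 l else d).
have Py j : (vmx v *m y) j 0 = d - dot n (v j).
  rewrite mxE big_ord_recl !mxE unlift_none mul1r; congr (_ + _).
  by rewrite /dot -sumrN; apply: eq_bigr => l _; rewrite !mxE liftK mulrN mulrC.
pose tau := d - dot n (v i).
have tau_gt0 : 0 < tau by rewrite subr_gt0.
have {}Py : vmx v *m y = tau *: delta_mx i 0.
  apply/colP => j; rewrite Py !mxE andbT.
  have [l ->|->] := unliftP i j; last by rewrite eqxx mulr1.
  by rewrite Hd subrr eq_sym eq_liftF mulr0.
have yE k : y k 0 = tau * invmx (vmx v) k i.
  rewrite -[y](mulKmx Pu) Py -scalemxAr mxE.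
  by rewrite -colE mxE.
have nE : n = - tau *: bgrad v i.
  apply/rowP => l; have := yE (lift ord0 l).
  by rewrite !mxE liftK mulNr => <-; rewrite opprK.
have g1 : tau ^+ 2 * dot (bgrad v i) (bgrad v i) = 1.
  rewrite -n1 nE /dot mulr_sumr; apply: eq_bigr => l _.
  by rewrite !mxE; ring.
have sg : tau * Num.sqrt (dot (bgrad v i) (bgrad v i)) = 1.
  by rewrite -[tau]gtr0_norm// -sqrtr_sqr -sqrtrM ?sqr_ge0// g1 sqrtr1.
rewrite facet_areaE// [in RHS]nE scalerA; congr (_ *: _).
set q := Num.sqrt _ in sg *.
by rewrite mulrN -[_ * q * tau]mulrA [q * tau]mulrC sg mulr1.
Qed.

Lemma baryE v x i : bary v x i
  = invmx (vmx v) ord0 i + dot x (bgrad v i).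
Proof.
rewrite /bary mxE big_ord_recl homog0 mul1r; congr (_ + _).
by apply: eq_bigr => l _; rewrite homogS mxE.
Qed.

(** With zero gradient coordinate [i] would be constant, but it is 1 at vertex [i] and 0 at another
    vertex, which exists since [N > 0]. *)
Lemma area_vec_neq0 v i : (0 < N)%N -> vmx v \in unitmx -> area_vec v i != 0.
Proof.
move=> N_gt0 Pu; rewrite /area_vec scaler_eq0 negb_or oppr_eq0 mulf_neq0/=.
- apply/eqP => g0; pose l := Ordinal N_gt0.
  have := bary_vertex i i Pu; have := bary_vertex (lift i l) i Pu.
  rewrite !baryE g0 eqxx [lift i l == i]eq_sym eq_liftF.
  have dot0 x : dot x 0 = 0 :> R.
    by rewrite /dot big1// => k _; rewrite mxE mulr0.
  by rewrite !dot0 !addr0 => -> /eqP; rewrite eqr_nat.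
- by rewrite normr_eq0 -unitfE -unitmxE.
- by rewrite invr_neq0// pnatr_eq0 -lt0n fact_gt0.
Qed.

Lemma facet_area_ge0 v i : 0 <= facet_area v i.
Proof. by rewrite mulr_ge0 ?sqrtr_ge0// invr_ge0 ler0n. Qed.

End AreaVector.

(** * Facets shared by two simplices *)

Section Twins.
Context {R : realType} {N : nat}.
Implicit Types (v w : 'I_N.+1 -> 'rV[R]_N) (i j : 'I_N.+1).

(** The second clause of [twin]. Both facets list N vertices, so for nondegenerate [v] this
    inclusion is an equality of vertex sets. *)
Definition facet_sub v i w j : Prop :=
  forall k : 'I_N, exists l : 'I_N, v (lift i k) = w (lift j l).

Lemma facet_sub_perm v i w j : vmx v \in unitmx -> facet_sub v i w j ->
  exists s : 'S_N, forall k, v (lift i k) = w (lift j (s k)).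
Proof.
move=> Pv /choice[s sE]; have s_inj : injective s.
  by move=> k l skl; apply/(@lift_inj _ i)/(vmx_inj Pv); rewrite !sE skl.
by exists (perm s_inj) => k; rewrite permE.
Qed.

Lemma facet_sub_sym v i w j : vmx v \in unitmx ->
  facet_sub v i w j -> facet_sub w j v i.
Proof.
move=> Pv /facet_sub_perm[//|s sE] k; exists ((s^-1)%g k).
by rewrite sE permKV.
Qed.

Lemma facet_sub_trans v i w j u k :
  facet_sub v i w j -> facet_sub w j u k -> facet_sub v i u k.
Proof. by move=> vw wu a; have [b ->] := vw a; exact: wu. Qed.

Lemma facet_sub_opp v i j : vmx v \in unitmx -> facet_sub v i v j -> i = j.
Proof.
move=> Pv /facet_sub_perm[//|s sE]; apply/eqP; apply: contraT => ij.
have [k ji|ji] := unliftP i j; last by rewrite ji eqxx in ij.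
have := sE k; rewrite -ji => /(vmx_inj Pv)/eqP.
by rewrite eq_liftF.
Qed.

Lemma normr_cofactor_facet v i w j k : vmx v \in unitmx -> facet_sub v i w j ->
  `|cofactor (vmx v) i k| = `|cofactor (vmx w) j k|.
Proof.
move=> Pv /facet_sub_perm[//|s sE].
have -> : cofactor (vmx v) i k = (-1) ^+ (i + k) *
    \det (row_perm s (row' j (col' k (vmx w)))).
  congr (_ * \det _); apply/matrixP => a b; rewrite !mxE sE//.
rewrite /cofactor row_permE det_mulmx det_perm !normrM.
by rewrite !normrX !normrN1 !expr1n !mul1r.
Qed.

(* Both sides are coefficient vectors of affine functions that vanish on the
   common facet, hence proportional. *)
Lemma bgrad_facet v i w j : vmx v \in unitmx -> vmx w \in unitmx ->
  facet_sub v i w j -> forall k,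
  invmx (vmx w) k j = bary w (v i) j * invmx (vmx v) k i.
Proof.
move=> Pv Pw vw k.
have E : vmx v *m col j (invmx (vmx w)) = bary w (v i) j *: delta_mx i 0.
  apply/colP => a; rewrite !mxE andbT.
  have -> : \sum_b vmx v a b * col j (invmx (vmx w)) b 0 = bary w (v a) j.
    by rewrite /bary mxE; apply: eq_bigr => b _; rewrite !mxE.
  have [l ->|->] := unliftP i a; last by rewrite eqxx mulr1.
  have [m ->] := vw l; rewrite bary_vertex// eq_sym eq_liftF.
  by rewrite [_ == i]eq_sym eq_liftF mulr0.
have := congr1 (fun z => (invmx (vmx v) *m z) k 0) E.
by rewrite /= mulKmx// mxE -scalemxAr mxE -colE mxE.
Qed.

(** The gradients differ by the factor [t = bary w (v i) j], and the equal facet minors make the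
    determinants differ by the inverse factor in absolute value. Only the sign of [t] survives;
    [t <= 0] says that [w] and [v i] lie on opposite sides of the facet. *)
Lemma area_vec_facet v i w j : vmx v \in unitmx -> vmx w \in unitmx ->
  facet_sub v i w j -> bary w (v i) j <= 0 -> area_vec w j = - area_vec v i.
Proof.
move=> Pv Pw vw t_le0; set t := bary w (v i) j in t_le0.
have gE k : invmx (vmx w) k j = t * invmx (vmx v) k i by exact: bgrad_facet.
have [k k_neq0] : exists k, invmx (vmx v) k i != 0.
  apply/existsP; apply: contraT; rewrite negb_exists => /forallP col0.
  have /matrixP/(_ i i) := mulmxV Pv; rewrite !mxE eqxx big1.
    by move/eqP; rewrite eq_sym oner_eq0.
  by move=> b _; move: (col0 b); rewrite negbK => /eqP ->; rewrite mulr0.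
have dE : `|\det (vmx w)| * - t = `|\det (vmx v)|.
  have := normr_cofactor_facet k Pv vw; rewrite -!det_invmx// gE !normrM mulrA.
  by rewrite (ler0_norm t_le0) => /(mulIf _) ->//; rewrite normr_eq0.
have wE : bgrad w j = t *: bgrad v i by apply/rowP => l; rewrite !mxE gE.
rewrite /area_vec wE -dE scalerA -[RHS]scaleNr; congr (_ *: _); ring.
Qed.

Lemma facet_overlap v i w j : vmx v \in unitmx -> vmx w \in unitmx ->
  facet_sub v i w j -> 0 < bary w (v i) j ->
  exists x, [/\ hull predT v x, hull predT w x & 0 < bary v x i].
Proof.
move=> Pv Pw vw t_gt0; have [s sE] := facet_sub_perm Pv vw.
(* The apex [v i] gets weight [e] and each facet vertex weight [e * A]: [A] outweighs the possibly
   negative coordinates of the apex in [w], and [e] normalizes the weights. *)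
pose A := \sum_k `|bary w (v i) k|.
have A_ge0 : 0 <= A by apply: sumr_ge0.
pose e := (1 + N%:R * A)^-1.
have NA_ge0 : 0 <= N%:R * A by rewrite mulr_ge0.
have e_gt0 : 0 < e by rewrite invr_gt0; lra.
have eE : e * (1 + N%:R * A) = 1 by rewrite mulVf//; lra.
pose c k := if unlift i k is Some _ then e * A else e.
have ci : c i = e by rewrite /c unlift_none.
have cl l : c (lift i l) = e * A by rewrite /c liftK.
have c_ge0 k : 0 <= c k by rewrite /c; case: unlift => *; nra.
have c1 : \sum_k c k = 1.
  rewrite (bigD1_ord i)//= ci (eq_bigr (fun=> e * A)) => [|l _]; last exact: cl.
  by rewrite sumr_const card_ord -[RHS]eE -mulr_natl; ring.
(* A point slightly above the barycenter of the common facet. *)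
exists (\sum_k c k *: v k); split.
- by exists c.
- apply: bary_ge0_hull => // k; rewrite bary_sum//.
  rewrite (bigD1_ord i)//= ci.
  have [k' ->|->] := unliftP j k.
    rewrite (bigD1 ((s^-1)%g k'))//= cl sE permKV bary_vertex// eqxx mulr1.
    rewrite addrA addr_ge0//.
      rewrite -mulrDr mulr_ge0 ?(ltW e_gt0)//.
      have : `|bary w (v i) (lift j k')| <= A.
        by rewrite /A (bigD1 (lift j k'))//= lerDl sumr_ge0.
      by move: (ler_norm (- bary w (v i) (lift j k'))); rewrite normrN; lra.
    apply: sumr_ge0 => l _; rewrite mulr_ge0//.
    by rewrite sE bary_vertex.
  rewrite addr_ge0 ?mulr_ge0 ?(ltW e_gt0) ?(ltW t_gt0)//.
  apply: sumr_ge0 => l _; rewrite mulr_ge0//.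
  by rewrite sE bary_vertex.
- rewrite bary_sum// (bigD1 i)//= big1 => [|k ki].
    by rewrite addr0 ci bary_vertex// eqxx mulr1.
  by rewrite bary_vertex// (negbTE ki) mulr0.
Qed.

End Twins.

(** * Closing of the area vectors over an element *)

Section Closure.
Context {R : realType} {N : nat} (M : mesh R N).
Implicit Types (f g : simp M * 'I_N.+1) (K : cell M).

Let Pu (T : simp M) : vmx (vtx T) \in unitmx.
Proof. exact/vmx_unit/simp_nondegenerate. Qed.

Definition avec f : 'rV[R]_N := area_vec (vtx f.1) f.2.

(** Were both simplices on the same side of the facet, they would share a point off it. Conformity
    would then make the opposite vertex of [f] a vertex of the other simplex, and the two would
    coincide. *)
Lemma twin_avec f g : twin (@vtx R N M) f g -> avec g = - avec f.
Proof.
move=> [fg sub]; apply: area_vec_facet => //; rewrite leNgt; apply/negP => t_gt0.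
have [x [xf xg xi]] := facet_overlap (Pu _) (Pu _) sub t_gt0.
have xh := simp_conforming (conj xf xg).
have fi : is_vertex (vtx g.1) (vtx f.1 f.2) by exact: bary_hull xh xi.
apply: fg; apply: simp_inj => k; have [l ->|->] := unliftP f.2 k => //.
by have [l' ->] := sub l; apply/existsP; exists (lift g.2 l').
Qed.

Lemma twin_sym f g : twin (@vtx R N M) f g -> twin (@vtx R N M) g f.
Proof. by move=> [/nesym fg sub]; split => //; exact: facet_sub_sym. Qed.


Hypothesis N_gt0 : (0 < N)%N.

(** Two twins of [f] in different simplices would be twins of each other. Their area vectors would
    be both equal and opposite, hence zero. *)
Lemma twin_uniq f g g' :
  twin (@vtx R N M) f g -> twin (@vtx R N M) f g' -> g = g'.
Proof.
move=> fg fg'; have [_ sub] := twin_sym fg; have [_ sub'] := fg'.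
have {sub'} sub := facet_sub_trans sub sub'.
have [g1|/eqP g1] := eqVneq g.1 g'.1.
  case: g g' g1 sub {fg fg'} => [T i] [T' i'] /= <- sub; congr (_, _).
  exact: facet_sub_opp sub.
have := twin_avec (conj g1 sub); rewrite (twin_avec fg) (twin_avec fg').
move=> /oppr_inj/eqP; rewrite -subr_eq0 opprK -mulr2n -scaler_nat.
by rewrite scaler_eq0 pnatr_eq0 (negbTE (area_vec_neq0 _ N_gt0 (Pu _))).
Qed.

(** Facets without a twin are sent to themselves, which makes this a total involution, usable for
    reindexing sums. *)
Definition twin_of f :=
  if pselect (exists g, twin (@vtx R N M) f g) is left fg then projT1 (cid fg)
  else f.

Lemma twin_ofP f g : twin (@vtx R N M) f g -> twin_of f = g.
Proof.
move=> fg; rewrite /twin_of; case: pselect => [h|]; last by case; exists g.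
by case: cid => g' /= /(twin_uniq fg).
Qed.

Lemma twin_of_id f : (forall g, ~ twin (@vtx R N M) f g) -> twin_of f = f.
Proof. by move=> no; rewrite /twin_of; case: pselect => // fg; have [g /no] := fg. Qed.

Lemma twin_ofK : involutive twin_of.
Proof.
move=> f; have [[g fg]|no] := pselect (exists g, twin (@vtx R N M) f g).
  by rewrite (twin_ofP fg); exact/twin_ofP/twin_sym.
by rewrite !twin_of_id// => g fg; apply: no; exists g.
Qed.

Lemma iface_facet s f : f \in facets s ->
  [/\ owner f.1 = cell_in s, twin (@vtx R N M) f (twin_of f)
    & owner (twin_of f).1 = cell_out s].
Proof.
move=> fs; have [_ _ [d /(_ f fs)[-> _]]] := iface_flat s.
by have [g fg go] := iface_twin fs; rewrite (twin_ofP fg).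
Qed.

Lemma iface_avec s f : f \in facets s ->
  avec f = facet_area (vtx f.1) f.2 *: normal s.
Proof.
move=> fs; have [_ n1 [d /(_ f fs)[_ fd]]] := iface_flat s.
exact: area_vecE fd.
Qed.

Lemma bface_avec b f : f \in bfacets b ->
  owner f.1 = bcell b /\ avec f = facet_area (vtx f.1) f.2 *: bnormal b.
Proof.
move=> fs; have [_ n1 [d /(_ f fs)[fo fd]]] := bface_flat b.
by split=> //; exact: area_vecE fd.
Qed.

Lemma area_dot s u : area s * dot u (normal s)
  = \sum_(f in facets s) dot u (avec f).
Proof.
rewrite /area mulr_suml; apply: eq_bigr => f fs.
by rewrite (iface_avec fs) dotZr.
Qed.

(** The sum includes the facets internal to [K], so each simplex of [K] closes separately. *)
Lemma cell_dot_avec K u : \sum_(f | owner f.1 == K) dot u (avec f) = 0.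
Proof.
rewrite (eq_bigl (fun f => (owner f.1 == K) && true)); last first.
  by move=> f; rewrite andbT.
rewrite -(pair_big (fun T => owner T == K) xpredT
  (fun T i => dot u (avec (T, i))))/=.
apply: big1 => T _; rewrite -dot_sumr.
have -> : \sum_i avec (T, i) = 0 by rewrite -[RHS](sum_area_vec (Pu T)).
by rewrite /dot big1// => j _; rewrite mxE mulr0.
Qed.

(** A facet of [K] with a twin is listed by one interior face, or its twin is, or the twin also
    belongs to [K]; these are the three terms. On a wall facet all terms vanish by the condition on
    [u]. *)
Lemma facet_dispatch K u f :
  (forall b, bcell b = K -> dot u (bnormal b) = 0) -> owner f.1 = K ->
  dot u (avec f) =
    \sum_s ((f \in facets s)%:R * dot u (avec f))
    + \sum_s ((twin_of f \in facets s)%:R * (owner (twin_of f).1 != K)%:R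
               * dot u (avec f))
    + (owner (twin_of f).1 == K)%:R * dot u (avec f).
Proof.
move=> ub fK; have [[g fg]|no] := pselect (exists g, twin (@vtx R N M) f g);
    last first.
  have [|b [fb _]] := @bface_cover _ _ M f.
    by move=> g fg; apply: no; exists g.
  have [fo ->] := bface_avec fb; rewrite dotZr ub -?fo//.
  by rewrite !mulr0 !big1 ?addr0// => s _; rewrite ?mulr0.
rewrite (twin_ofP fg).
have [gK|gK] := eqVneq (owner g.1) K.
  rewrite !big1 ?add0r ?mul1r// => s _; first by rewrite mulr0 mul0r.
  case: (boolP (f \in facets s)) => [fs|]; last by rewrite mul0r.
  have [fi _ go] := iface_facet fs; rewrite (twin_ofP fg) in go.
  by case: (@iface_sides _ _ M s); rewrite -fi -go fK.
have [|s [fgs s_uniq]] := iface_cover fg; first by apply/eqP; rewrite fK eq_sym.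
have fNg s' : (f \in facets s') && (g \in facets s') = false.
  apply/negP => /andP[/iface_facet[fi _ _] /iface_facet[gi _ _]].
  by move: gK; rewrite gi -fi fK eqxx.
rewrite mul0r addr0 -big_split/= (bigD1 s)//= big1 ?addr0 => [|s' s's].
  move: (fNg s); case: fgs => ->; rewrite ?andbT ?andTb => ->;
    by rewrite ?mul0r ?mul1r ?addr0 ?add0r.
case: (boolP (f \in facets s')) => fs'.
  by move: s's; rewrite (s_uniq s' (or_introl fs')) eqxx.
case: (boolP (g \in facets s')) => gs'.
  by move: s's; rewrite (s_uniq s' (or_intror gs')) eqxx.
by rewrite !mul0r addr0.
Qed.

Lemma dot_avec_twin K u f :
  (forall b, bcell b = K -> dot u (bnormal b) = 0) -> owner f.1 = K ->
  dot u (avec (twin_of f)) = - dot u (avec f).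
Proof.
move=> ub fK; have [[g fg]|no] := pselect (exists g, twin (@vtx R N M) f g).
  by rewrite (twin_ofP fg) (twin_avec fg) dotNr.
have no' g : ~ twin (@vtx R N M) f g by move=> fg; apply: no; exists g.
have [b [fb _]] := bface_cover no'.
have [fo ->] := bface_avec fb; rewrite twin_of_id//.
by have [_ ->] := bface_avec fb; rewrite dotZr ub -?fo// mulr0 oppr0.
Qed.

(* The divergence theorem for a constant vector on one element. *)
Lemma cell_closure K u :
  (forall b, bcell b = K -> dot u (bnormal b) = 0) ->
  \sum_s area s * (((cell_in s == K)%:R - (cell_out s == K)%:R)
                   * dot u (normal s)) = 0.
Proof.
move=> ub.
(* Exchanging twins inside [K] reverses the area vectors, so this sum is its own opposite. *)
have twinS : \sum_(f | owner f.1 == K)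
    (owner (twin_of f).1 == K)%:R * dot u (avec f) = 0.
  set S := LHS; suff : S = - S by move/eqP; rewrite eq_sym eqNr => /eqP.
  rewrite {1}/S (reindex_inj (inv_inj twin_ofK))/= /S -sumrN.
  rewrite big_mkcond [RHS]big_mkcond; apply: eq_bigr => f _.
  rewrite twin_ofK; do 2 case: eqP => ?; rewrite ?mul0r ?oppr0// !mul1r.
  exact: (dot_avec_twin ub).
rewrite -[RHS](cell_dot_avec K u).
under [RHS]eq_bigr => f /eqP fK do rewrite (facet_dispatch ub fK).
rewrite !big_split/= twinS addr0 exchange_big/= (exchange_big _ _ _ _ xpredT)/=.
rewrite -big_split/=; apply: eq_bigr => s _.
rewrite mulrCA area_dot mulrBl; congr (_ + _).
  rewrite mulr_sumr big_mkcond [RHS]big_mkcond; apply: eq_bigr => f _.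
  case: ifPn => [fs|_]; last by case: ifP; rewrite ?mul0r.
  have [<- _ _] := iface_facet fs.
  by case: eqP => _; rewrite ?mul0r ?mul1r.
(* Faces whose normal points into [K] list the twins of the facets of [K]; passing to the twin costs
   a sign. *)
rewrite [RHS](reindex_inj (inv_inj twin_ofK))/= -mulrN -sumrN mulr_sumr.
rewrite big_mkcond [RHS]big_mkcond; apply: eq_bigr => f _.
rewrite twin_ofK; case: ifPn => [fs|_]; last by case: ifP; rewrite ?mul0r.
have [-> ft ->] := iface_facet fs; have /eqP := @iface_sides _ _ M s.
have [-> ->|_ _] := eqVneq (cell_out s) K; last by rewrite mul0r.
by rewrite !mul1r (twin_avec ft) dotNr.
Qed.

End Closure.

(** * Entropy balance of an element *)

(** Convexity of the exponential between [gamma * y] and 0, with weight [gamma^-1] on the former. *)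
Lemma bernoulli_expR (R : realType) (gamma y : R) : 1 < gamma ->
  1 + gamma * (expR y - 1) <= expR (gamma * y).
Proof.
move=> g1.
have g01 : 0 <= gamma^-1 <= 1.
  by rewrite invr_ge0 invf_le1 ?(ltW g1)//=; lra.
pose t := @Itv01 R _ (andP g01).1 (andP g01).2.
have := convex_expR t (gamma * y : R^o) (0 : R^o).
rewrite !convRE/= expR0.
have -> : gamma^-1 * (gamma * y) = y by field; rewrite gt_eqF//; lra.
rewrite mulr0 addr0 mulr1 /unstable.onem => H.
have {}H := ler_wpM2l (ltW (lt_trans ltr01 g1)) H.
move: H; rewrite mulrDr mulrBr mulr1 mulrA divff ?mul1r ?gt_eqF//; lra.
Qed.


(** The numerical flux from [K] to its neighbour [L], with [v] the mean normal velocity towards [L];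
    it does not depend on the orientation chosen for the face. *)
Definition out_flux (R : realType) (v mu gK gL : R) : R :=
  (gK + gL) / 2 * v - `|v| / 2 * (gL - gK) - mu * (gL - gK).

(* The face terms of the entropy balance of [K]; [a] and [b] are the outer
   normal velocities in [K] and in the neighbour [L], and [B] is the weight
   with which the flux takes its value from [L]. *)
Lemma face_entropy_ge (R : realType) (gamma pK pL rK rL mu q H a b v : R) :
  1 < gamma -> 0 < pK -> 0 < rK -> 0 < rL ->
  v = (a + b) / 2 -> 0 <= mu -> 0 <= q -> 0 <= H ->
  1 + gamma * (rL / rK - 1) <= pL / pK ->
  (gamma - 1) * a <=
    (gamma - 1) / pK *
      (- out_flux v mu (pK / (gamma - 1)) (pL / (gamma - 1) + rL * q / 2)
       - pK / 2 * (b - a) + H * (q / 2))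
    + gamma / rK * out_flux v mu rK rL.
Proof.
move=> g1 pK0 rK0 rL0 vE mu0 q0 H0 key.
pose B := (`|v| - v) / 2 + mu.
have B0 : 0 <= B by rewrite addr_ge0// divr_ge0// subr_ge0 ler_norm.
rewrite -subr_ge0.
(* After eliminating [b], pressure and density enter only through the Bernoulli gap [key]; the terms
   in [q], the squared velocity jump, are the dissipation. *)
have -> : (gamma - 1) / pK *
      (- out_flux v mu (pK / (gamma - 1)) (pL / (gamma - 1) + rL * q / 2)
       - pK / 2 * (b - a) + H * (q / 2))
    + gamma / rK * out_flux v mu rK rL - (gamma - 1) * a
  = B * (pL / pK - (1 + gamma * (rL / rK - 1)))
    + (gamma - 1) / pK * (B * (rL * q / 2) + H * (q / 2)).
  rewrite /out_flux /B; set A := `|v|; have -> : b = 2 * v - a by rewrite vE; field.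
  by field; rewrite !gt_eqF//; lra.
rewrite addr_ge0//; first by rewrite mulr_ge0// subr_ge0.
rewrite mulr_ge0//; first by rewrite divr_ge0//; lra.
by rewrite addr_ge0// !mulr_ge0//; lra.
Qed.

Section CellEntropy.
Context {R : realType} {N : nat} (M : mesh R N).
Implicit Types (K L : cell M) (s : iface M).

Lemma vol_gt0 K : 0 < vol K.
Proof.
have [T TK] := owner_surj K; rewrite /vol (bigD1 T) ?TK ?eqxx//=.
rewrite ltr_pwDl ?simp_nondegenerate// sumr_ge0// => T' _.
exact/ltW/simp_nondegenerate.
Qed.

Lemma area_ge0 s : 0 <= area s.
Proof. by apply: sumr_ge0 => f _; exact: facet_area_ge0. Qed.

(** The sign of the face normal relative to the outer normal of [K], and 0 if [s] is not a face of
    [K]. *)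
Definition orient K s : R := (cell_in s == K)%:R - (cell_out s == K)%:R.

Definition ind K : Qh M := fun L => (L == K)%:R.

Lemma jump_ind K s : jump (ind K) s = - orient K s.
Proof. by rewrite /jump /ind /orient opprB. Qed.

Lemma jump_indV K (u : QhV M) s :
  jump (fun L => ind K L *: u L) s = - orient K s *: u K.
Proof.
rewrite /jump /ind /orient opprB scalerBl; congr (_ - _).
  by case: eqP => [->|]; rewrite ?scale0r.
by case: eqP => [->|]; rewrite ?scale0r.
Qed.

Lemma int_dom_ind K (f : Qh M) : int_dom (fun L => f L * ind K L) = vol K * f K.
Proof.
rewrite /int_dom (bigD1 K)//= /ind eqxx mulr1 big1 ?addr0// => L /negbTE ->.
by rewrite !mulr0.
Qed.

Lemma dot_fluxV (mu : iface M -> R) (r u : QhV M) s y :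
  dot (fluxV mu r u s) y = flux mu (fun L => dot (r L) y) u s.
Proof.
have -> : fluxV mu r u s =
    (2^-1 * dot (avgV u s) (normal s)) *: (r (cell_in s) + r (cell_out s))
    - (2^-1 * `|dot (avgV u s) (normal s)| + mu s)
      *: (r (cell_out s) - r (cell_in s)).
  by apply/rowP => j; rewrite !mxE /flux /Up /avg /jump; ring.
rewrite /flux /Up; set v := dot (avgV u s) (normal s).
by rewrite dotBl !dotZl dotDl dotBl /avg /jump; ring.
Qed.

Variables (gamma alpha h : R) (mu : iface M -> R) (V : set (QhV M)).
Variables (X : state M) (drho : Qh M) (dmom : QhV M) (dener : Qh M).
Hypothesis N_gt0 : (0 < N)%N.
Hypothesis gamma_gt1 : 1 < gamma.
Hypothesis mu_ge0 : forall s, 0 <= mu s.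
Hypothesis rho_gt0 : forall K, 0 < rho X K.
Hypothesis p_gt0 : forall K, 0 < pressure gamma X K.
Hypothesis u_wall : no_flux (velocity X).
Hypothesis subV : @no_flux R N M `<=` V.
Hypothesis eqC : continuity_eq mu X drho.
Hypothesis eqM : momentum_eq V gamma alpha h mu X dmom.
Hypothesis eqE : energy_eq gamma alpha h mu X dener.

Let u := velocity X.
Let p := pressure gamma X.
Let H := h `^ (alpha - 1).

Let momE K : mom X K = rho X K *: u K.
Proof. by rewrite /u /velocity scalerA divff ?scale1r// gt_eqF. Qed.

Let enerE K : ener X K = p K / (gamma - 1) + rho X K * dot (u K) (u K) / 2.
Proof.
rewrite /p /pressure !momE dotZl dotZr; field.
by rewrite !gt_eqF//; have := gamma_gt1; lra.
Qed.

Lemma cell_continuity K :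
  vol K * drho K = \sum_s area s * (flux mu (rho X) u s * - orient K s).
Proof.
have := eqC (ind K); rewrite int_dom_ind => /eqP; rewrite subr_eq0 => /eqP ->.
by apply: eq_bigr => s _; rewrite jump_ind.
Qed.

Lemma cell_momentum K : vol K * dot (dmom K) (u K) =
  \sum_s area s * (- orient K s *
    (dot (fluxV mu (mom X) u s) (u K) + avg p s * dot (normal s) (u K)
     - H * dot (jump u s) (u K))).
Proof.
have /eqM : V (fun L => ind K L *: u L).
  by apply: subV => b; rewrite dotZl u_wall mulr0.
rewrite -/u -/p -/H /int_faces mulr_sumr.
have -> : int_dom (fun L => dot (dmom L) (ind K L *: u L))
    = vol K * dot (dmom K) (u K).
  rewrite -(int_dom_ind K (fun L => dot (dmom L) (u L))).
  by apply: eq_bigr => L _; rewrite dotZr [ind _ _ * _]mulrC.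
set A := \sum_s _; set B := \sum_s _; set C := \sum_s _ => E.
transitivity (A + B - C); first by lra.
rewrite /A /B /C -big_split/= -sumrB; apply: eq_bigr => s _.
rewrite jump_indV !(dotZr (- orient K s)). ring.
Qed.

Lemma cell_energy K : vol K * dener K =
  \sum_s area s *
    (- orient K s * (flux mu (ener X) u s + avg p s * dot (normal s) (u K)
       - H * dot (jump u s) (avgV u s))
     - p K / 2 * (ind K (cell_in s) + ind K (cell_out s))
       * dot (jump u s) (normal s)).
Proof.
have := eqE (ind K).
rewrite -/u -/p -/H /int_faces mulr_sumr int_dom_ind.
set A := \sum_s _; set B := \sum_s _; set D := \sum_s _; set C := \sum_s _ => E.
transitivity (A + B - D - C); first by lra.
rewrite /A /B /C /D -big_split/= -!sumrB; apply: eq_bigr => s _.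
rewrite jump_indV jump_ind (dotZl (- orient K s)) (dotC (u K)).
have -> : avg (fun L => p L * ind K L) s
    = p K / 2 * (ind K (cell_in s) + ind K (cell_out s)).
  have pind L : p L * ind K L = p K * ind K L.
    by rewrite /ind; case: eqP => [->|]; rewrite ?mulr0.
  by rewrite /avg !pind; ring.
by ring.
Qed.

(* [gamma - 1] times this is the time derivative of the pressure. *)
Definition d_internal K : R :=
  dener K - dot (dmom K) (u K) + dot (u K) (u K) / 2 * drho K.

(** With [u K] frozen, linearity of the flux merges the three balances into one flux, and the mean
    pressure terms of (M) and (E) cancel. *)
Lemma cell_internal_energy K : vol K * d_internal K =
  \sum_s area s *
    (- orient K s * (flux mu (fun L => ener X L - dot (mom X L) (u K)
                              + dot (u K) (u K) / 2 * rho X L) u s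
       - H * (dot (jump u s) (avgV u s) - dot (jump u s) (u K)))
     - p K / 2 * (ind K (cell_in s) + ind K (cell_out s))
       * dot (jump u s) (normal s)).
Proof.
rewrite /d_internal mulrDr mulrBr cell_energy cell_momentum.
rewrite [vol K * (_ * _)]mulrCA cell_continuity mulr_sumr -sumrB -big_split/=.
apply: eq_bigr => s _; rewrite dot_fluxV /flux /Up /avg /jump; ring.
Qed.

Lemma cell_entropy_ge K :
  (forall L, ln (p K) - gamma * ln (rho X K) <= ln (p L) - gamma * ln (rho X L)) ->
  0 <= (gamma - 1) * d_internal K / p K - gamma * (drho K / rho X K).
Proof.
move=> Kmin.
have key L : 1 + gamma * (rho X L / rho X K - 1) <= p L / p K.
  have -> : rho X L / rho X K = expR (ln (rho X L) - ln (rho X K)).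
    by rewrite -ln_div ?posrE// lnK// posrE divr_gt0.
  apply: (le_trans (bernoulli_expR _ gamma_gt1)).
  rewrite -[leRHS]lnK ?posrE ?divr_gt0// ler_expR ln_div ?posrE//.
  by have := Kmin L; lra.
have H_ge0 : 0 <= H by exact: powR_ge0.
rewrite -(pmulr_rge0 _ (vol_gt0 K)).
have -> : vol K * ((gamma - 1) * d_internal K / p K - gamma * (drho K / rho X K))
  = (gamma - 1) / p K * (vol K * d_internal K)
    - gamma / rho X K * (vol K * drho K) by ring.
(* The closure identity replaces the lower bound 0 by a sum over faces, so that the comparison can
   be made face by face. *)
have /(congr1 ( *%R (gamma - 1))) : \sum_s area s * (orient K s *
   dot (u K) (normal s)) = 0.
  apply: cell_closure => [|b bK].
    exact: N_gt0.
  by rewrite -bK u_wall.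
rewrite mulr0 => <-.
rewrite cell_internal_energy cell_continuity !mulr_sumr -sumrB.
apply: ler_sum => s _; rewrite !(mulrCA _ (area s)) -mulrBr.
rewrite ler_wpM2l ?area_ge0//.
have := @iface_sides _ _ M s; rewrite /orient /ind /flux /Up.
have vE : dot (avgV u s) (normal s) =
  (dot (u (cell_in s)) (normal s) + dot (u (cell_out s)) (normal s)) / 2.
  by rewrite /avgV dotZl dotDl; field.
have uE : dot (jump u s) (normal s) =
  dot (u (cell_out s)) (normal s) - dot (u (cell_in s)) (normal s).
  by rewrite /jump dotBl.
(* In the frame moving with [u K] the energy of [L] is its internal energy plus the kinetic energy
   of the relative velocity. *)
have gE L : ener X L - dot (mom X L) (u K) + dot (u K) (u K) / 2 * rho X L
    = p L / (gamma - 1) + rho X L * dot (u L - u K) (u L - u K) / 2.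
  rewrite enerE momE (dotZl (rho X L)) dotBr !dotBl (dotC (u K) (u L)).
  by field; rewrite subr_eq0 gt_eqF.
have gK : ener X K - dot (mom X K) (u K) + dot (u K) (u K) / 2 * rho X K
    = p K / (gamma - 1).
  by rewrite gE dotBr subrr mulr0 mul0r addr0.
have [inK|_] := eqVneq (cell_in s) K; have [outK|_] := eqVneq (cell_out s) K;
  rewrite -?[true%:R]/(1 : R) -?[false%:R]/(0 : R).
- by rewrite inK outK.
- move=> _; set L := cell_out s in vE uE *.
  have := face_entropy_ge gamma_gt1 (p_gt0 K) (rho_gt0 K) (rho_gt0 L) vE
    (mu_ge0 s) (dot_ge0 (u L - u K)) H_ge0 (key L).
  have jE : dot (jump u s) (avgV u s) - dot (jump u s) (u K)
      = dot (u L - u K) (u L - u K) / 2.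
    by rewrite /jump /avgV inK; exact: dot_sub_mean_l.
  rewrite inK in vE uE *; rewrite jE uE /avg /jump inK -/L gK gE -/p => ineq.
  rewrite subr0 mul1r; apply: (le_trans ineq).
  rewrite le_eqVlt; apply/orP; left; apply/eqP; rewrite /out_flux; ring.
- move=> _; set L := cell_in s in vE uE *.
  (* Here the normal points into [K], so all normal velocities change sign. *)
  have v'E : - dot (avgV u s) (normal s) =
      (- dot (u K) (normal s) + - dot (u L) (normal s)) / 2.
    by rewrite vE outK; ring.
  have := face_entropy_ge gamma_gt1 (p_gt0 K) (rho_gt0 K) (rho_gt0 L) v'E
    (mu_ge0 s) (dot_ge0 (u L - u K)) H_ge0 (key L).
  have jE : dot (jump u s) (avgV u s) - dot (jump u s) (u K)
      = - (dot (u L - u K) (u L - u K) / 2).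
    by rewrite /jump /avgV outK; exact: dot_sub_mean_r.
  rewrite outK in uE *; rewrite jE uE /avg /jump outK -/L gK gE -/p => ineq.
  rewrite sub0r mulN1r mulrN -mulrN; apply: (le_trans ineq).
  rewrite le_eqVlt; apply/orP; left; apply/eqP; rewrite /out_flux normrN; ring.
- by move=> _; rewrite subrr addr0 oppr0 !(mulr0, mul0r) !subr0 mulr0.
Qed.

End CellEntropy.

(** * Evolution in time *)

(** The slopes from the left are nonpositive and converge to [a]. A left neighbourhood suffices,
    which covers a minimum at the right end of a time interval. *)
Lemma le0_derivative_at_left_min (R : realType) (f : R -> R) (x d a : R) :
  d < x -> is_derive x 1 f a -> (forall z, d < z < x -> f x <= f z) -> a <= 0.
Proof.
move=> dx /is_derive1_caratheodory[g [gE gc <-]] fmin.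
have gl : g z @[z --> x^'-] --> g x by exact: cvg_at_left_filter.
apply: (cvgr_to_le gl); near=> z.
have zx : z < x by near: z; exact: nbhs_left_lt.
have : f x <= f z by apply: fmin; rewrite zx andbT; near: z; exact: nbhs_left_gt.
rewrite -subr_ge0 gE => H; rewrite leNgt; apply/negP => gz; nra.
Unshelve. all: by end_near.
Qed.

(* Adding [e t] makes the derivative strictly positive wherever the minimum
   over [I] is attained, so that the minimum over [0, T] is not attained at a
   positive time. *)
Lemma min_family_ge (R : realType) (I : finType) (f df : I -> R -> R) (a : R) :
  (forall i, {within `[0, +oo[, continuous (f i)}) ->
  (forall i (t : R), 0 < t -> is_derive t 1 (f i) (df i t)) ->
  (forall i t, 0 < t -> (forall j, f i t <= f j t) -> 0 <= df i t) ->
  (forall i, a <= f i 0) -> forall t, 0 <= t -> forall i, a <= f i t.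
Proof.
move=> fc fd fmin f0 T T_ge0 i0; rewrite leNgt; apply/negP => fT.
have T_gt0 : 0 < T.
  by rewrite lt_neqAle T_ge0 andbT; apply: contraTneq fT => <-; rewrite -leNgt.
(* The perturbation uses up half of the gap at [T]: [g i0 T] stays below [a], so the minimum is not
   attained at time 0 either. *)
pose e := (a - f i0 T) / (2 * T).
have e_gt0 : 0 < e by rewrite divr_gt0 ?mulr_gt0// subr_gt0.
have eT : e * T = (a - f i0 T) / 2.
  by rewrite /e; field; rewrite ?gt_eqF.
pose g i t := f i t + e * t.
have gc i : {within `[0, T], continuous (g i)}.
  move=> x; apply: continuousD; last first.
    by apply: continuous_subspaceT => y; exact: mulrl_continuous.
  apply: (continuous_subspaceW _ (fc i)) => y /=; rewrite !in_itv/= andbT.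
  by case/andP.
have /choice[m mP] i : exists c, c \in `[0, T] /\
    forall t, t \in `[0, T] -> g i c <= g i t.
  by have [c c1 c2] := EVT_min T_ge0 (gc i); exists c.
pose k := [arg min_(i < i0) g i (m i)]%O.
have kmin j t : t \in `[0, T] -> g k (m k) <= g j t.
  move=> tT; apply: (@le_trans _ _ (g j (m j))); last exact: (mP j).2.
  by rewrite /k; case: arg_minP => // i _; apply.
have [mk0T _] := mP k; have := mk0T; rewrite in_itv/= => /andP[mk_ge0 mk_le].
have mk_gt0 : 0 < m k.
  rewrite lt_neqAle mk_ge0 andbT; apply/negP => /eqP mk0.
  have := kmin i0 T; rewrite in_itv/= lexx T_ge0 -mk0 /g mulr0 addr0 eT => /(_ isT).
  by have := f0 k; lra.
(* The term [e * t] is common to all indices, so [f k] is also minimal among the [f j] at time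
   [m k]. *)
have dk : 0 <= df k (m k).
  by apply: fmin => // j; have := kmin j _ mk0T; rewrite /g lerD2r.
suff : df k (m k) + e <= 0 by lra.
have gd : is_derive (m k) 1 (g k) (df k (m k) + e).
  have ? := fd k _ mk_gt0.
  have -> : g k = f k + cst e * id by [].
  by apply: is_derive_eq; rewrite scaler0 addr0 /GRing.scale/= mulr1.
apply: (le0_derivative_at_left_min mk_gt0 gd) => z /andP[z_gt0 z_lt].
by apply: kmin; rewrite in_itv/= (ltW z_gt0)/= (le_trans (ltW z_lt)).
Qed.

(** * Time derivative and continuity of the logarithmic entropy *)

Section TimeDerivative.
Context {R : realType} {N : nat} (M : mesh R N).
Variables (gamma : R) (X : R -> state M) (K : cell M).

Lemma is_derive_mom2 (t : R) (dm : 'rV[R]_N) :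
  (forall j, is_derive t 1 (fun t => mom (X t) K 0 j) (dm 0 j)) ->
  is_derive t 1 (fun t => dot (mom (X t) K) (mom (X t) K))
    (2 * dot dm (mom (X t) K)).
Proof.
move=> dmE.
have -> : (fun t => dot (mom (X t) K) (mom (X t) K)) =
    \sum_j (fun t => mom (X t) K 0 j) * (fun t => mom (X t) K 0 j).
  by apply/funext => z; rewrite fct_sumE.
apply: (is_derive_eq (is_derive_sum (fun j => is_deriveM (dmE j) (dmE j)))).
rewrite /dot mulr_sumr; apply: eq_bigr => j _.
by rewrite /GRing.scale/=; ring.
Qed.

Lemma is_derive_pressure (t : R) (dm : QhV M) (dE : Qh M) (dR : Qh M) :
  0 < rho (X t) K ->
  is_derive t 1 (fun t => rho (X t) K) (dR K) ->
  is_derive t 1 (fun t => ener (X t) K) (dE K) ->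
  (forall j, is_derive t 1 (fun t => mom (X t) K 0 j) (dm K 0 j)) ->
  is_derive t 1 (fun t => pressure gamma (X t) K)
    ((gamma - 1) * d_internal (X t) dR dm dE K).
Proof.
move=> r_gt0 dRE dEE /is_derive_mom2 dmE.
have r_neq0 : rho (X t) K != 0 by rewrite gt_eqF.
have dV := is_deriveV r_neq0 dRE.
have -> : (fun t => pressure gamma (X t) K) =
    cst (gamma - 1) * ((fun t => ener (X t) K) - cst 2^-1 *
      ((fun t => dot (mom (X t) K) (mom (X t) K)) * (fun t => (rho (X t) K)^-1))).
  by [].
apply: is_derive_eq.
rewrite /d_internal /velocity dotZr dotZl !dotZr /cst /GRing.scale/=.
by field.
Qed.

Lemma is_derive_log_entropy (t : R) (dm : QhV M) (dE : Qh M) (dR : Qh M) :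
  0 < rho (X t) K -> 0 < pressure gamma (X t) K ->
  is_derive t 1 (fun t => rho (X t) K) (dR K) ->
  is_derive t 1 (fun t => ener (X t) K) (dE K) ->
  (forall j, is_derive t 1 (fun t => mom (X t) K 0 j) (dm K 0 j)) ->
  is_derive t 1
    (fun t => ln (pressure gamma (X t) K) - gamma * ln (rho (X t) K))
    ((gamma - 1) * d_internal (X t) dR dm dE K / pressure gamma (X t) K
     - gamma * (dR K / rho (X t) K)).
Proof.
move=> r_gt0 p_gt0 dRE dEE dmE.
have dp := is_derive_pressure r_gt0 dRE dEE dmE.
have dlp := is_derive1_comp (g := fun t => pressure gamma (X t) K)
  (is_derive1_ln p_gt0) dp.
have dlr := is_derive1_comp (g := fun t => rho (X t) K)
  (is_derive1_ln r_gt0) dRE.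
have -> : (fun t => ln (pressure gamma (X t) K) - gamma * ln (rho (X t) K)) =
  (@ln R \o (fun t => pressure gamma (X t) K))
  - cst gamma * (@ln R \o (fun t => rho (X t) K)) by [].
apply: is_derive_eq.
by rewrite /GRing.scale/= /cst; ring.
Qed.

(** Differentiability is given only for positive times; this carries the initial bound over from
    time 0. *)
Lemma log_entropy_continuous :
  {within `[0, +oo[, continuous (fun t => rho (X t) K)} ->
  {within `[0, +oo[, continuous (fun t => ener (X t) K)} ->
  (forall j, {within `[0, +oo[, continuous (fun t => mom (X t) K 0 j)}) ->
  (forall t, 0 <= t -> 0 < rho (X t) K /\ 0 < pressure gamma (X t) K) ->
  {within `[0, +oo[, continuous
     (fun t => ln (pressure gamma (X t) K) - gamma * ln (rho (X t) K))}.
Proof.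
move=> /subspace_continuousP rc /subspace_continuousP ec mc pos.
apply/subspace_continuousP => t t0.
have [r_gt0 p_gt0] : 0 < rho (X t) K /\ 0 < pressure gamma (X t) K.
  by apply: pos; move: t0; rewrite /= in_itv/= andbT.
have {}rc := rc t t0; have {}ec := ec t t0.
have pc : pressure gamma (X z) K @[z --> within `[0, +oo[ (nbhs t)]
    --> pressure gamma (X t) K.
  apply: cvgM; first exact: cvg_cst.
  apply: cvgB => //; apply: cvgM; first exact: cvg_cst.
  apply: cvgM; last by apply: cvgV => //; rewrite gt_eqF.
  apply: cvg_big => [|j _]; first exact: add_continuous.
  by apply: cvgM; exact: (proj1 (subspace_continuousP _ _) (mc j)).
apply: cvgB.
  by apply: (continuous_cvg _ _ pc); exact: continuous_ln.
by apply: cvgM; [exact: cvg_cst|apply: (continuous_cvg _ _ rc); exact: continuous_ln].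
Qed.

(** Rests on [theta = p / rho] and [c_v + 1 = gamma c_v]. *)
Lemma entropyE (Y : state M) : 0 < rho Y K -> 0 < pressure gamma Y K ->
  1 < gamma ->
  entropy gamma Y K
  = (gamma - 1)^-1 * (ln (pressure gamma Y K) - gamma * ln (rho Y K)).
Proof.
move=> r_gt0 p_gt0 g1.
have T_gt0 : 0 < temperature gamma Y K by exact: divr_gt0.
rewrite /entropy ln_div ?posrE ?powR_gt0// ln_powR /temperature.
rewrite ln_div ?posrE//; field.
by rewrite subr_eq0 gt_eqF.
Qed.

End TimeDerivative.

Theorem mainTheorem2 (R : realType) (N : nat) (hN : (1 <= N <= 3)%N)
  (M : mesh R N) (h c : R) (h_gt0 : 0 < h) (c_gt0 : 0 < c)
  (hM : size_comparable M h c)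
  (gamma alpha : R) (gamma_gt1 : 1 < gamma)
  (mu : R -> iface M -> R) (mu_ge0 : forall t s, 0 <= t -> 0 <= mu t s)
  (V : set (QhV M)) (hV : @no_flux R N M `<=` V)
  (X0 : state M) (hX0 : admissible X0)
  (X : R -> state M) (hX_init : X 0 = X0)
  (hX : global_solution V gamma alpha h mu X)
  (s0 : R) (hs0 : forall K : cell M, s0 < entropy gamma X0 K) :
  forall t : R, 0 <= t -> forall K : cell M, s0 <= entropy gamma (X t) K.
Proof.
case: hX => Xc Xd Xeq Xwall Xpos t t_ge0 K.
have N_gt0 : (0 < N)%N by case/andP: hN.
have g1 : 0 < gamma - 1 by rewrite subr_gt0.
have [rt pt] := Xpos t t_ge0 K.
(* Multiplied by [gamma - 1 > 0], the claim is a lower bound [s0 * (gamma - 1)] for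
   [ln p - gamma ln rho]. *)
rewrite entropyE// mulrC ler_pdivlMr//.
pose dr t := fun L => derive1 (fun t => rho (X t) L) t.
pose dE t := fun L => derive1 (fun t => ener (X t) L) t.
pose dm t : QhV M := fun L => \row_j derive1 (fun t => mom (X t) L 0 j) t.
apply: (min_family_ge
  (f := fun L t => ln (pressure gamma (X t) L) - gamma * ln (rho (X t) L))
  (df := fun L t =>
    (gamma - 1) * d_internal (X t) (dr t) (dm t) (dE t) L / pressure gamma (X t) L
    - gamma * (dr t L / rho (X t) L))) => //.
- move=> L; have [rc ec mc] := Xc L.
  by apply: log_entropy_continuous => // z z_ge0; exact: Xpos.
- move=> L z z_gt0; have [rd ed md] := Xd z z_gt0 L.
  have [rz pz] := Xpos z (ltW z_gt0) L.
  apply: is_derive_log_entropy => //.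
  + by rewrite /dr derive1E; exact/derivableP.
  + by rewrite /dE derive1E; exact/derivableP.
  + by move=> j; rewrite mxE derive1E; exact/derivableP.
- move=> L z z_gt0 Lmin; have [eqC eqM eqE] := Xeq z z_gt0.
  apply: (cell_entropy_ge N_gt0 gamma_gt1 _ _ _ _ hV eqC eqM eqE) => //.
  + by move=> s; exact: mu_ge0 (ltW z_gt0).
  + by move=> K'; have [] := Xpos z (ltW z_gt0) K'.
  + by move=> K'; have [] := Xpos z (ltW z_gt0) K'.
  + exact: Xwall (ltW z_gt0).
- move=> L; have [r0 p0] := Xpos 0 (lexx 0) L.
  have := hs0 L; rewrite -hX_init entropyE// mulrC ltr_pdivlMr//.
  exact: ltW.
Qed.
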